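(* Let $\boldsymbol{X}:U\to LC^*$ be a spacelike surface in the lightcone and let $\boldsymbol{X}^\ell:U\to LC^*$ be the $\Delta_4$-dual of $\boldsymbol{X}$. Then the following conditions are equivalent: 1) $M=\boldsymbol{X}(U)$ is a marginally trapped surface. 2) $H_\ell\equiv0$. 3) The mean curvature vector $\mathfrak{H}(p)$ is zero or parallel to $\boldsymbol{X}(u)$ at any $p=\boldsymbol{X}(u)$. 4) $K_I\equiv0$. 5) The Gaussian curvature vector $\mathfrak{K}(p)$ is zero or parallel to $\boldsymbol{X}(u)$ at any $p=\boldsymbol{X}(u)$.
   Context: $\mathbb{R}^4_1$ is $\mathbb{R}^4$ with $\langle \boldsymbol{x},\boldsymbol{y}\rangle_1=-x_0y_0+x_1y_1+x_2y_2+x_3y_3$; a nonzero vector is spacelike, timelike or lightlike if $\langle\boldsymbol{x},\boldsymbol{x}\rangle_1$ is $>0$, $<0$ or $=0$. $LC^*=\{\boldsymbol{x}\neq\boldsymbol{0}:\langle\boldsymbol{x},\boldsymbol{x}\rangle_1=0\}$ is the open lightcone. A spacelike surface $\boldsymbol{X}:U\to LC^*\subset\mathbb{R}^4_1$ ($U\subset\mathbb{R}^2$ open) is a smooth embedding whose tangent planes consist (apart from $0$) of spacelike vectors; $M=\boldsymbol{X}(U)$ is identified with $U$. Let $\Delta_4=\{(\boldsymbol{v},\boldsymbol{w})\in LC^*\times LC^*:\langle\boldsymbol{v},\boldsymbol{w}\rangle_1=-2\}$, with contact structure $K_4=\theta_{41}^{-1}(0)=\theta_{42}^{-1}(0)$,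 where $\theta_{41}=\langle d\boldsymbol{v},\boldsymbol{w}\rangle_1|_{\Delta_4}$, $\theta_{42}=\langle\boldsymbol{v},d\boldsymbol{w}\rangle_1|_{\Delta_4}$. The $\Delta_4$-dual (lightcone Gauss image) $\boldsymbol{X}^\ell:U\to LC^*$ is the unique map such that $u\mapsto(\boldsymbol{X}(u),\boldsymbol{X}^\ell(u))$ is a Legendrian embedding into $\Delta_4$; that is, $\langle\boldsymbol{X},\boldsymbol{X}^\ell\rangle_1=-2$ and $\langle\boldsymbol{X}_{u_i},\boldsymbol{X}^\ell\rangle_1=0$ for $i=1,2$. The lightcone shape operator is $S^\ell_p=-d\boldsymbol{X}^\ell(u):T_pM\to T_pM$, $p=\boldsymbol{X}(u)$, and the lightcone mean curvature is $H_\ell(p)=\frac12\mathrm{Trace}\,S^\ell_p$. Along $M$ use the normal frame $\boldsymbol{n}^T=(\boldsymbol{X}+\boldsymbol{X}^\ell)/2$ (unit timelike) and $\boldsymbol{n}^S=(\boldsymbol{X}-\boldsymbol{X}^\ell)/2$ (unit spacelike). With $\pi^t$ the orthogonal projection onto $T_pM$, set $S_p(\boldsymbol{n}^T)=-\pi^t\circ d_p\boldsymbol{n}^T$ and $S_p(\boldsymbol{n}^S)=-\pi^t\circ d_p\boldsymbol{n}^S$. The mean curvature vector is $\mathfrak{H}(p)=\frac12\mathrm{Trace}\,S_p(\boldsymbol{n}^T)\,\boldsymbol{n}^T+\frac12\mathrm{Trace}\,S_p(\boldsymbol{n}^S)\,\boldsymbol{n}^S$ and the Gaussian curvature vector is $\mathfrak{K}(p)=\det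 S_p(\boldsymbol{n}^T)\,\boldsymbol{n}^T+\det S_p(\boldsymbol{n}^S)\,\boldsymbol{n}^S$. $M$ is marginally trapped if $\mathfrak{H}(p)$ is isotropic (zero or lightlike) at every $p$. $K_I$ is the intrinsic Gauss (sectional) curvature of the induced Riemannian metric on $M$. *)

(* Defs.v *)
From HB Require Import structures.
From mathcomp Require Import all_boot all_order all_algebra.
From mathcomp Require Import all_classical all_reals topology normedtype derive.

Set Implicit Arguments.
Unset Strict Implicit.
Unset Printing Implicit Defensive.

Import Order.TTheory GRing.Theory Num.Theory.
Import numFieldNormedType.Exports.

Local Open Scope classical_set_scope.
Local Open Scope ring_scope.

Section Smooth.
Context {R : realType} {V W : normedModType R}.

(* Used for U open in a finite-dimensional V, where it is the usual C^k. *)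
Fixpoint Ck_on (k : nat) (U : set V) (f : V -> W) : Prop :=
  match k with
  | 0 => forall u, U u -> {for u, continuous f}
  | k'.+1 => (forall u, U u -> differentiable f u) /\
             (forall v : V, Ck_on k' U ('D_v f))
  end.

Definition smooth_on (U : set V) (f : V -> W) : Prop :=
  forall k, Ck_on k U f.

(* An injective immersion which is open onto its image; together with
   continuity, the last clause says that f is a homeomorphism from U to f(U). *)
Definition smooth_embedding (U : set V) (f : V -> W) : Prop :=
  [/\ smooth_on U f,
      (forall u v, U u -> U v -> f u = f v -> u = v),
      (forall u, U u -> injective ('d f u)) &
      (forall A : set V, open A -> A `<=` U ->
         exists2 B : set W, open B & f @` A = B `&` f @` U)].

End Smooth.

Section Minkowski.
Context {R : realType}.
Implicit Types x y : 'rV[R]_4.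

Definition lorentz x y : R :=
  - (x 0 0 * y 0 0) + x 0 1 * y 0 1 + x 0 2 * y 0 2 + x 0 3 * y 0 3.

Definition spacelike x : Prop := x != 0 /\ 0 < lorentz x x.
Definition lightlike x : Prop := x != 0 /\ lorentz x x = 0.
Definition isotropic x : Prop := x = 0 \/ lightlike x.

Definition LCstar : set 'rV[R]_4 := [set x | lightlike x].

Definition parallel x y : Prop := exists2 c : R, c != 0 & x = c *: y.

Definition Delta4 : set ('rV[R]_4 * 'rV[R]_4) :=
  [set p | [/\ LCstar p.1, LCstar p.2 & lorentz p.1 p.2 = - 2]].

(* The 1-form <dv, w> at p = (v, w), evaluated at a tangent vector t.  On
   Delta4 it is the opposite of <v, dw>, so both have the same kernel. *)
Definition theta41 (p t : 'rV[R]_4 * 'rV[R]_4) : R := lorentz t.1 p.2.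

(* Row space: the Lorentz-orthogonal complement of the row space of A. *)
Definition lorentz_perp m (A : 'M[R]_(m, 4)) : 'M[R]_4 :=
  kermx (lin1_mx (fun x : 'rV[R]_4 => \row_(i < m) lorentz x (row i A))).

(* Acting on row vectors from the right: the projection onto the row space of
   A along its Lorentz-orthogonal complement. *)
Definition lorentz_proj m (A : 'M[R]_(m, 4)) : 'M[R]_4 :=
  proj_mx <<A>>%MS (lorentz_perp A).

End Minkowski.

Section Curvature.
Context {R : realType}.

Definition partial {W : normedModType R} (i : 'I_2) (f : 'rV[R]_2 -> W) :
  'rV[R]_2 -> W := 'D_(delta_mx 0 i) f.

(* [christoffel g k i j] is Gamma^k_ij. *)
Definition christoffel (g : 'rV[R]_2 -> 'M[R]_2) (k i j : 'I_2)
    (u : 'rV[R]_2) : R :=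
  2^-1 * \sum_l invmx (g u) k l *
    (partial i (fun v => g v j l) u + partial j (fun v => g v i l) u
     - partial l (fun v => g v i j) u).

(* The l-th component of R(d_i, d_j) d_k, where
   R(x, y) z = nabla_x nabla_y z - nabla_y nabla_x z - nabla_[x,y] z. *)
Definition riemann (g : 'rV[R]_2 -> 'M[R]_2) (l i j k : 'I_2)
    (u : 'rV[R]_2) : R :=
  partial i (christoffel g l j k) u - partial j (christoffel g l i k) u
  + \sum_m (christoffel g l i m u * christoffel g m j k u
            - christoffel g l j m u * christoffel g m i k u).

(* g(R(d_1, d_2) d_2, d_1) / (g_11 g_22 - g_12 ^ 2) *)
Definition sectional_curvature (g : 'rV[R]_2 -> 'M[R]_2) (u : 'rV[R]_2) : R :=
  (\sum_l riemann g l 0 1 1 u * g u l 0)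
  / (g u 0 0 * g u 1 1 - g u 0 1 ^+ 2).

End Curvature.

Section Surfaces.
Context {R : realType}.
Implicit Types (U : set 'rV[R]_2) (X Xl n : 'rV[R]_2 -> 'rV[R]_4).
Implicit Types u : 'rV[R]_2.

Definition spacelike_surface U X : Prop :=
  [/\ smooth_embedding U X,
      (forall u, U u -> LCstar (X u)) &
      (forall u w, U u -> 'd X u w != 0 -> spacelike ('d X u w))].

Definition legendrian_embedding U
    (L : 'rV[R]_2 -> 'rV[R]_4 * 'rV[R]_4) : Prop :=
  [/\ smooth_embedding U L,
      (forall u, U u -> Delta4 (L u)) &
      (forall u w, U u -> theta41 (L u) ('d L u w) = 0)].

Definition Delta4_dual U X Xl : Prop :=
  legendrian_embedding U (fun u => (X u, Xl u)).

(* The rows of the Jacobian ['J X u] are X_{u_1}(u) and X_{u_2}(u), a basis of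
   the tangent plane at X(u).  An endomorphism S of that plane is represented
   in this basis by the matrix s with S(X_{u_i}) = sum_j s_ij X_{u_j}.  If B
   has rows S(X_{u_i}), then s is the only solution of [s *m 'J X u = B], that
   is, [B *m pinvmx ('J X u)]. *)
Definition tangent_endo_mx X u (B : 'M[R]_(2, 4)) : 'M[R]_2 :=
  B *m pinvmx ('J X u).

Definition lightcone_shape_operator X Xl u : 'M[R]_2 :=
  tangent_endo_mx X u (- 'J Xl u).

Definition lightcone_mean_curvature X Xl u : R :=
  2^-1 * \tr (lightcone_shape_operator X Xl u).

Definition shape_operator X n u : 'M[R]_2 :=
  tangent_endo_mx X u (- ('J n u *m lorentz_proj ('J X u))).

Definition nT X Xl u : 'rV[R]_4 := 2^-1 *: (X u + Xl u).
Definition nS X Xl u : 'rV[R]_4 := 2^-1 *: (X u - Xl u).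

Definition mean_curvature_vector X Xl u : 'rV[R]_4 :=
  (2^-1 * \tr (shape_operator X (nT X Xl) u)) *: nT X Xl u
  + (2^-1 * \tr (shape_operator X (nS X Xl) u)) *: nS X Xl u.

Definition gaussian_curvature_vector X Xl u : 'rV[R]_4 :=
  \det (shape_operator X (nT X Xl) u) *: nT X Xl u
  + \det (shape_operator X (nS X Xl) u) *: nS X Xl u.

Definition marginally_trapped U X Xl : Prop :=
  forall u, U u -> isotropic (mean_curvature_vector X Xl u).

Definition induced_metric X u : 'M[R]_2 :=
  \matrix_(i, j) lorentz (partial i X u) (partial j X u).

Definition intrinsic_gauss_curvature X u : R :=
  sectional_curvature (induced_metric X) u.

End Surfaces.

(* Main.v *)
From HB Require Import structures.
Require Import Defs.
From mathcomp Require Import all_boot all_order all_algebra.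
From mathcomp Require Import all_classical all_reals topology normedtype derive.
From mathcomp Require Import ring lra.

Import Order.TTheory GRing.Theory Num.Theory.
Import numFieldNormedType.Exports.

Local Open Scope classical_set_scope.
Local Open Scope ring_scope.

(** All five conditions say that the lightcone mean curvature H vanishes, and
each of them is compared with H pointwise.

Write Y for the dual of X.  The normal plane at X(u) is spanned by the null
vectors X and Y, whose product is - 2.  Differentiating the constant products
of X and Y shows that the derivatives of Y are orthogonal to X and Y, hence
tangent ([tangentP]): the shape operator s of Y satisfies s X_i = - Y_i with no
normal part.  The field X itself has shape operator - 1, so nT and nS have
shape operators (s - 1) / 2 and - (s + 1) / 2.  Taking traces and determinants
gives
  mean curvature vector     = - X / 2 + (H / 2) Y,
  Gaussian curvature vector = ((det s + 1) / 4) X - (H / 2) Y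
([mean_curvature_vectorE], [gaussian_curvature_vectorE]).  A combination
a X + b Y has square - 4 a b, and its product with X is - 2 b; so the first
vector is isotropic exactly when H = 0, and each of the two is zero or parallel
to X exactly when H = 0.

The intrinsic curvature is in fact equal to H ([intrinsic_gauss_curvatureE]).
By the Gauss equation ([gauss_equation]), K_I det g is the product of the
normal parts of X_00 and X_11 minus the square of the normal part of X_01.
The normal part of X_ij has product - g_ij with X and (s g)_ij with Y, so it is
(g_ij / 2) Y - ((s g)_ij / 2) X, and the difference is
(g_00 (s g)_11 + g_11 (s g)_00 - g_01 (s g)_10 - g_01 (s g)_01) / 2
= (tr s / 2) det g.

The Gauss equation is derived from the definition of the Christoffel symbols
in terms of the metric.  It needs the symmetry of the second derivatives
([derive_swap]) and the differentiability of the Christoffel symbols. *)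

(** * Symmetry of second derivatives *)

Section SymmetryOfSecondDerivatives.
Context {R : realType} {V : normedModType R}.
Implicit Types (f : V -> R) (u v w : V).

Lemma mean_value_from0 (phi dphi : R -> R) (h : R) : 0 <= h ->
  (forall t, 0 <= t <= h -> is_derive t 1 phi (dphi t)) ->
  exists2 c, 0 <= c <= h & phi h - phi 0 = h * dphi c.
Proof.
move=> h0 dp.
have [||c] := @MVT_segment R phi dphi 0 h h0.
- by move=> x; rewrite in_itv/= => /andP[x0 xh]; apply: dp; rewrite !ltW.
- apply: derivable_within_continuous => x; rewrite in_itv/= => xh.
  by have [] := dp _ xh.
- by rewrite in_itv/= => ch ->; exists c => //; rewrite subr0 mulrC.
Qed.

Lemma is_derive_along_line f u v (t : R) :
  differentiable f (u + t *: v) ->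
  is_derive t 1 (fun s => f (u + s *: v)) ('D_v f (u + t *: v)).
Proof.
move=> df.
have dl : is_diff t (fun s : R => u + s *: v) (fun s => s *: v).
  by apply: is_diff_eq; rewrite add0r.
have dc : differentiable (f \o (fun s : R => u + s *: v)) t.
  exact: differentiable_comp.
apply: DeriveDef; first exact: diff_derivable.
by rewrite deriveE// diff_comp//= deriveE// diff_val scale1r.
Qed.

(** The mean value theorem along v for the difference of f between opposite
sides of the parallelogram, then along w for the derivative so obtained. *)
Lemma second_difference f p r u v w (h : R) : 0 <= h ->
  (forall s t, 0 <= s <= h -> 0 <= t <= h ->
     let x := u + s *: v + t *: w in
     [/\ differentiable f x, 'D_v f x = p x,
         differentiable p x & 'D_w p x = r x]) ->
  exists s t, [/\ 0 <= s <= h, 0 <= t <= h &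
    f (u + h *: v + h *: w) - f (u + h *: v) - f (u + h *: w) + f u
      = h * (h * r (u + s *: v + t *: w))].
Proof.
move=> h0 df; have hh : 0 <= h <= h by rewrite h0 lexx.
have zh : (0 : R) <= 0 <= h by rewrite h0 lexx.
pose phi (s : R) := f (u + h *: w + s *: v) - f (u + s *: v).
have [s sh phiE] : exists2 s, 0 <= s <= h & phi h - phi 0 =
    h * (p (u + h *: w + s *: v) - p (u + s *: v)).
  pose dphi (s : R) := p (u + h *: w + s *: v) - p (u + s *: v).
  apply: (@mean_value_from0 phi dphi h h0) => s sh.
  rewrite /dphi; apply: is_deriveB.
    have [/= dfx pE _ _] := df s h sh hh; rewrite addrAC in dfx pE.
    rewrite -pE; exact: is_derive_along_line.
  have [] := df s 0 sh zh; rewrite /= scale0r addr0 => dfx <- _ _.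
  exact: is_derive_along_line.
pose psi (t : R) := p (u + s *: v + t *: w).
have [t th psiE] : exists2 t, 0 <= t <= h &
    psi h - psi 0 = h * r (u + s *: v + t *: w).
  pose dpsi (t : R) := r (u + s *: v + t *: w).
  apply: (@mean_value_from0 psi dpsi h h0) => t th.
  have [/= _ _ dpx] := df s t sh th; rewrite /dpsi => <-; exact: is_derive_along_line.
exists s, t; split => //; rewrite -psiE /psi scale0r addr0 (addrAC u (s *: v)) -phiE.
rewrite /phi scale0r !addr0 (addrAC u (h *: v)); ring.
Qed.

Lemma small_parallelogram (A : set V) u v w : nbhs u A ->
  exists2 h : R, 0 < h & forall s t, 0 <= s <= h -> 0 <= t <= h ->
    A (u + s *: v + t *: w).
Proof.
move=> /nbhs_ballP[e /= e0 eA].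
pose k := `|v| + `|w| + 1.
have k0 : 0 < k by rewrite ltr_wpDl// addr_ge0.
exists (e / k); first by rewrite divr_gt0.
move=> s t /andP[s0 sh] /andP[t0 th]; apply: eA.
rewrite -ball_normE /ball_/= -addrA opprD addrA subrr add0r normrN.
apply: le_lt_trans (ler_normD _ _) _.
rewrite !normrZ !ger0_norm//.
have h0 : 0 < e / k by rewrite divr_gt0.
have -> : e = e / k * `|v| + e / k * `|w| + e / k.
  by rewrite -mulrDr -[X in _ + X]mulr1 -mulrDr -/k divfK ?gt_eqF.
by rewrite ltr_pwDr// lerD// ler_wpM2r.
Qed.

(** The second difference of f over a small parallelogram with sides along v
and w is a value of either mixed derivative near the base point, so the two
mixed derivatives take common values arbitrarily close to that point.  The
derivatives are named by functions that agree with them on U only: this lets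
coordinates of a derivative stand for derivatives of coordinates. *)
Lemma derive_swap (U : set V) f p q r s u v w : open U -> U u ->
  (forall x, U x -> differentiable f x) ->
  (forall x, U x -> 'D_v f x = p x) -> (forall x, U x -> 'D_w f x = q x) ->
  (forall x, U x -> differentiable p x) ->
  (forall x, U x -> differentiable q x) ->
  (forall x, U x -> 'D_w p x = r x) -> (forall x, U x -> 'D_v q x = s x) ->
  {for u, continuous r} -> {for u, continuous s} -> r u = s u.
Proof.
move=> oU Uu df fp fq dp dq pr qs cr cs; apply/eqP/negP => /negP ne.
pose e := `|r u - s u| / 2.
have e0 : 0 < e by rewrite divr_gt0// normr_gt0 subr_eq0.
pose A := [set x | [/\ U x, `|r u - r x| < e & `|s u - s x| < e]].
have nA : nbhs u A.
  have nU : nbhs u U by apply: open_nbhs_nbhs; split.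
  move/cvgrPdist_lt : cr => /(_ e e0) nr.
  move/cvgrPdist_lt : cs => /(_ e e0) ns.
  by apply: filterS3 nU nr ns => x; split.
have [h h0 hA] := small_parallelogram A u v w nA.
have [] := @second_difference f p r u v w h (ltW h0).
  move=> a b ah bh; have [Ux _ _] := hA _ _ ah bh.
  by split; [exact: df|exact: fp|exact: dp|exact: pr].
move=> a [b [ah bh Er]].
have [] := @second_difference f q s u w v h (ltW h0).
  move=> c d ch dh; rewrite /= addrAC; have [Ux _ _] := hA _ _ dh ch.
  by split; [exact: df|exact: fq|exact: dq|exact: qs].
move=> c [d [ch dh Es]].
have [_ near_r _] := hA _ _ ah bh.
have [_ _ near_s] := hA _ _ dh ch.
have Ers : r (u + a *: v + b *: w) = s (u + d *: v + c *: w).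
  apply: (mulfI (lt0r_neq0 h0)); apply: (mulfI (lt0r_neq0 h0)).
  rewrite (addrAC u (d *: v)) -Er -Es (addrAC u (h *: v) (h *: w)); ring.
rewrite Ers in near_r; rewrite distrC in near_s.
have := le_lt_trans (ler_distD _ _ _) (ltrD near_r near_s).
by rewrite /e -splitr ltxx.
Qed.

End SymmetryOfSecondDerivatives.

(** * Smooth maps and their coordinates *)

Section SmoothMaps.
Context {R : realType} {V W : normedModType R}.
Implicit Types (U : set V) (f : V -> W).

Lemma smooth_on_differentiable {U f u} :
  smooth_on U f -> U u -> differentiable f u.
Proof. by move=> sf Uu; have [df _] := sf 1; exact: df. Qed.

Lemma smooth_on_derive {U f} v : smooth_on U f -> smooth_on U ('D_v f).
Proof. by move=> sf k; have [_] := sf k.+1; apply. Qed.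

Lemma open_near {U u} : open U -> U u -> \near u, U u.
Proof. by move=> oU Uu; apply: open_nbhs_nbhs; split. Qed.

Lemma derive_eq_on {U : set V} {f g : V -> W} {u} v : open U -> U u ->
  (forall x, U x -> f x = g x) -> 'D_v f u = 'D_v g u.
Proof.
move=> oU Uu fg; apply: near_eq_derive.
by apply: filterS (open_near oU Uu) => x; apply: fg.
Qed.

Lemma derivable_eq_on {U : set V} {f g : V -> W} {u} v : open U -> U u ->
  (forall x, U x -> f x = g x) -> derivable f u v -> derivable g u v.
Proof.
move=> oU Uu fg; apply: near_eq_derivable.
by apply: filterS (open_near oU Uu) => x; apply: fg.
Qed.

End SmoothMaps.

Section Coordinates.
Context {R : realType} {V : normedModType R} {n : nat}.
Implicit Types (U : set V) (f : V -> 'rV[R]_n).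

Lemma derive_coord f x v k : derivable f x v ->
  'D_v (fun y => f y 0 k) x = 'D_v f x 0 k.
Proof. by move=> df; rewrite (derive_mx df) mxE. Qed.

Lemma derivable_coord f x v k : derivable f x v ->
  derivable (fun y => f y 0 k) x v.
Proof. by move=> /derivable_mxP. Qed.

Lemma differentiable_coord_comp f x k : differentiable f x ->
  differentiable (fun y => f y 0 k) x.
Proof.
move=> df; apply: (@differentiable_comp _ _ _ _ f (fun M : 'rV_n => M 0 k)) => //.
exact: differentiable_coord.
Qed.

Lemma smooth_on_derive_swap {U f u} v w : open U -> smooth_on U f -> U u ->
  'D_v ('D_w f) u = 'D_w ('D_v f) u.
Proof.
move=> oU sf Uu; apply/rowP => k.
have dcoord (g : V -> 'rV_n) a x : smooth_on U g -> U x ->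
    'D_a (fun y => g y 0 k) x = 'D_a g x 0 k.
  move=> sg Ux; apply/derive_coord/diff_derivable.
  exact: smooth_on_differentiable sg Ux.
have diffcoord (g : V -> 'rV_n) x : smooth_on U g -> U x -> differentiable (fun y => g y 0 k) x.
  move=> sg Ux; apply/differentiable_coord_comp.
  exact: smooth_on_differentiable sg Ux.
have s1 a := smooth_on_derive a sf.
have s2 a b := smooth_on_derive b (s1 a).
apply: (@derive_swap _ _ U (fun y => f y 0 k) (fun y => 'D_w f y 0 k)
  (fun y => 'D_v f y 0 k) (fun y => 'D_v ('D_w f) y 0 k)
  (fun y => 'D_w ('D_v f) y 0 k) u w v oU Uu).
- by move=> x; exact: diffcoord sf.
- by move=> x; exact: dcoord sf.
- by move=> x; exact: dcoord sf.
- by move=> x; exact: diffcoord (s1 w).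
- by move=> x; exact: diffcoord (s1 v).
- by move=> x; exact: dcoord (s1 w).
- by move=> x; exact: dcoord (s1 v).
- exact: differentiable_continuous (diffcoord _ _ (s2 w v) Uu).
- exact: differentiable_continuous (diffcoord _ _ (s2 v w) Uu).
Qed.

End Coordinates.

(** * The Lorentz form *)

Section LorentzForm.
Context {R : realType}.
Implicit Types x y z : 'rV[R]_4.

Lemma lorentzC x y : lorentz x y = lorentz y x.
Proof. rewrite /lorentz; ring. Qed.

Lemma lorentzDl x y z : lorentz (x + y) z = lorentz x z + lorentz y z.
Proof. rewrite /lorentz !mxE; ring. Qed.

Lemma lorentzZl c x y : lorentz (c *: x) y = c * lorentz x y.
Proof. rewrite /lorentz !mxE; ring. Qed.

Lemma lorentzDr x y z : lorentz z (x + y) = lorentz z x + lorentz z y.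
Proof. by rewrite lorentzC lorentzDl !(lorentzC z). Qed.

Lemma lorentzZr c x y : lorentz y (c *: x) = c * lorentz y x.
Proof. by rewrite lorentzC lorentzZl (lorentzC y). Qed.

Lemma lorentz0l x : lorentz 0 x = 0.
Proof. by rewrite -(scale0r 0) lorentzZl mul0r. Qed.

Lemma lorentzNl x y : lorentz (- x) y = - lorentz x y.
Proof. by rewrite -scaleN1r lorentzZl mulN1r. Qed.

Lemma lorentz_suml n (F : 'I_n -> 'rV_4) y :
  lorentz (\sum_i F i) y = \sum_i lorentz (F i) y.
Proof.
by apply: (big_morph (lorentz^~ y)) => [a b|]; rewrite ?lorentzDl ?lorentz0l.
Qed.

Lemma lorentz_mulmxl n (c : 'rV_n) (A : 'M_(n, 4)) y :
  lorentz (c *m A) y = \sum_i c 0 i * lorentz (row i A) y.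
Proof.
by rewrite mulmx_sum_row lorentz_suml; under eq_bigr do rewrite lorentzZl.
Qed.

Lemma is_derive_lorentz {V : normedModType R} (f g : V -> 'rV[R]_4) (u v : V) :
  derivable f u v -> derivable g u v ->
  is_derive u v (fun s => lorentz (f s) (g s))
    (lorentz ('D_v f u) (g u) + lorentz (f u) ('D_v g u)).
Proof.
move=> df dg.
have h (e : V -> 'rV_4) k : derivable e u v ->
    is_derive u v (fun s => e s 0 k) ('D_v e u 0 k).
  by move=> de; apply: DeriveDef; [exact: derivable_coord|exact: derive_coord].
pose F k s : R := f s 0 k * g s 0 k.
have hF k : is_derive u v (F k)
    (f u 0 k * 'D_v g u 0 k + g u 0 k * 'D_v f u 0 k).
  exact: is_deriveM (h f k df) (h g k dg).
have -> : (fun s => lorentz (f s) (g s)) = - F 0 + F 1 + F 2 + F 3 by [].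
have H0 := is_deriveN (hF 0).
have H1 := is_deriveD H0 (hF 1).
have H2 := is_deriveD H1 (hF 2).
apply: is_derive_eq (is_deriveD H2 (hF 3)) _.
rewrite /lorentz.
move: ('D_v f u) ('D_v g u) (f u) (g u) => a b c d.
ring.
Qed.

End LorentzForm.

(** * Two by two matrices *)

Section DimensionTwo.
Context {R : comNzRingType}.

Lemma ord2P (k : 'I_2) : k = 0 \/ k = 1.
Proof. by case: k => [[|[|]]//] ?; [left|right]; apply/val_inj. Qed.

Lemma sum_ord2 (F : 'I_2 -> R) : \sum_l F l = F 0 + F 1.
Proof. by rewrite big_ord_recl big_ord1; congr (_ + F _); apply/val_inj. Qed.

Lemma det_mx22 (A : 'M[R]_2) : \det A = A 0 0 * A 1 1 - A 0 1 * A 1 0.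
Proof.
rewrite (expand_det_row _ 0) sum_ord2 /cofactor !det_mx11 !mxE /=.
rewrite expr0 expr1 mul1r mulN1r mulrN.
by congr (_ * A _ _ - _ * A _ _); apply/val_inj.
Qed.

End DimensionTwo.

Lemma cramer2 (F : fieldType) (a b d x y p q : F) : a * d - b * b != 0 ->
  x * a + y * b = p -> x * b + y * d = q ->
  (p * d - q * b) / (a * d - b * b) = x /\ (q * a - p * b) / (a * d - b * b) = y.
Proof.
move=> D0 <- <-; split; apply: (canLR (mulfK D0)); ring.
Qed.

(** * The Gauss equation *)

Section GaussEquation.
Context {R : realType}.
Implicit Types (U : set 'rV[R]_2) (X : 'rV[R]_2 -> 'rV[R]_4) (u : 'rV[R]_2).
Implicit Types i j k l m : 'I_2.

(** The Christoffel symbols are the tangential coordinates of the second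
derivatives of X, so this is the normal part of X_jk. *)
Definition second_fundamental_form X j k u : 'rV[R]_4 :=
  partial j (partial k X) u
  - \sum_l christoffel (induced_metric X) l j k u *: partial l X u.

Lemma partialC {U X u} i j : open U -> smooth_on U X -> U u ->
  partial i (partial j X) u = partial j (partial i X) u.
Proof. by move=> oU sX Uu; exact: smooth_on_derive_swap oU sX Uu. Qed.

Lemma induced_metricC X u j l :
  induced_metric X u j l = induced_metric X u l j.
Proof. by rewrite [LHS]mxE [RHS]mxE; exact: lorentzC. Qed.

Lemma is_derive_induced_metric {U X u} i j l : smooth_on U X -> U u ->
  is_derive u (delta_mx 0 i) (fun v => induced_metric X v j l)
    (lorentz (partial i (partial j X) u) (partial l X u)
     + lorentz (partial j X u) (partial i (partial l X) u)).
Proof.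
move=> sX Uu.
have -> : (fun v => induced_metric X v j l) =
    (fun v => lorentz (partial j X v) (partial l X v)).
  by apply/funext => v; rewrite mxE.
by apply: is_derive_lorentz; apply: diff_derivable;
  apply: (smooth_on_differentiable (smooth_on_derive _ sX) Uu).
Qed.

Lemma partial_induced_metric {U X u} i j l : smooth_on U X -> U u ->
  partial i (fun v => induced_metric X v j l) u =
  lorentz (partial i (partial j X) u) (partial l X u)
  + lorentz (partial j X u) (partial i (partial l X) u).
Proof. by move=> sX Uu; have [] := is_derive_induced_metric i j l sX Uu. Qed.

(** In the sum of three derivatives of the metric the terms cancel in pairs by the
symmetry of second derivatives. *)
Lemma christoffelE {U X u} k i j : open U -> smooth_on U X -> U u ->
  christoffel (induced_metric X) k i j u =
  \sum_l invmx (induced_metric X u) k l *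
    lorentz (partial i (partial j X) u) (partial l X u).
Proof.
move=> oU sX Uu; rewrite /christoffel mulr_sumr; apply: eq_bigr => l _.
rewrite mulrCA; congr (_ * _).
(* Abstract names for the derivatives: rewriting would otherwise unfold them
   to compare one with another. *)
pose P a := partial a X u; pose Q a b := partial a (partial b X) u.
have QC a b : Q a b = Q b a := partialC a b oU sX Uu.
have dg a b c : partial a (fun v => induced_metric X v b c) u =
    lorentz (Q a b) (P c) + lorentz (P b) (Q a c).
  exact: partial_induced_metric sX Uu.
rewrite !dg -/(P l) -/(Q i j); clearbody P Q.
rewrite (QC j i) (QC l i) (QC l j) (lorentzC (P j)) (lorentzC (P i)).
lra.
Qed.

(** That is, the Christoffel symbols are the tangential coordinates of X_ij: the
metric and its inverse cancel. *)
Lemma christoffel_induced_metric {U X u} i j m :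
  open U -> smooth_on U X -> U u -> induced_metric X u \in unitmx ->
  \sum_l christoffel (induced_metric X) l i j u * induced_metric X u l m =
  lorentz (partial i (partial j X) u) (partial m X u).
Proof.
move=> oU sX Uu gU.
pose c : 'cV[R]_2 :=
  \col_l lorentz (partial i (partial j X) u) (partial l X u).
transitivity ((induced_metric X u *m (invmx (induced_metric X u) *m c)) m 0).
  rewrite [RHS]mxE; apply: eq_bigr => l _.
  rewrite (christoffelE _ _ _ oU sX Uu) mulrC induced_metricC; congr (_ * _).
  by rewrite [RHS]mxE; apply: eq_bigr => p _; congr (_ * _); rewrite [RHS]mxE.
by rewrite mulKVmx// mxE.
Qed.

(** Where the metric is invertible, Cramer's rule writes the Christoffel symbols as quotients of
polynomials in products of derivatives of X. *)
Lemma derivable_christoffel {U X u} k i j v : open U -> smooth_on U X -> U u ->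
  (forall x, U x -> induced_metric X x \in unitmx) ->
  derivable (christoffel (induced_metric X) k i j) u v.
Proof.
move=> oU sX Uu gU.
pose g a b := fun x => induced_metric X x a b.
pose c a := fun x => lorentz (partial i (partial j X) x) (partial a X x).
pose D := g 0 0 * g 1 1 - g 0 1 * g 0 1.
have dP a x : U x -> derivable (partial a X) x v.
  move=> Ux; apply: diff_derivable.
  exact: smooth_on_differentiable (smooth_on_derive _ sX) Ux.
have dc a : derivable (c a) u v.
  apply: @ex_derive (is_derive_lorentz _ _ u v _ (dP a u Uu)); apply: diff_derivable.
  exact: smooth_on_differentiable (smooth_on_derive _ (smooth_on_derive _ sX)) Uu.
have dg a b : derivable (g a b) u v.
  have -> : g a b = fun x => lorentz (partial a X x) (partial b X x).
    by apply/funext => x; rewrite /g mxE.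
  exact: @ex_derive (is_derive_lorentz _ _ u v (dP a u Uu) (dP b u Uu)).
have Dn0 x : U x -> D x != 0.
  move=> /gU; rewrite unitmxE unitfE det_mx22.
  by rewrite (induced_metricC X x 1 0).
have cE l x : U x ->
    christoffel (induced_metric X) 0 i j x * g 0 l x +
    christoffel (induced_metric X) 1 i j x * g 1 l x = c l x.
  by move=> Ux; have := christoffel_induced_metric i j l oU sX Ux (gU x Ux);
    rewrite sum_ord2.
have g10 x : g 1 0 x = g 0 1 x by exact: induced_metricC.
(* Cramer's rule for the two linear equations cE. *)
pose N a b := (c a * g b b - c b * g 0 1) * (fun x => (D x)^-1).
have dN a b : derivable (N a b) u v.
  apply: derivableM.
    by apply: derivableB; apply: derivableM.
  apply: derivableV (Dn0 u Uu) _.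
  by apply: derivableB; apply: derivableM.
have NE x : U x -> N 0 1 x = christoffel (induced_metric X) 0 i j x /\
                  N 1 0 x = christoffel (induced_metric X) 1 i j x.
  move=> Ux; apply: cramer2 (Dn0 x Ux) _ _; first by rewrite -(cE 0 x Ux) g10.
  exact: cE 1 x Ux.
have [->|->] := ord2P k.
- by apply: derivable_eq_on oU Uu _ (dN 0 1) => x /NE[].
- by apply: derivable_eq_on oU Uu _ (dN 1 0) => x /NE[].
Qed.

(** The derivative of [christoffel_induced_metric] along the i-th coordinate. *)
Lemma partial_christoffel_metric {U X u} i j k m :
  open U -> smooth_on U X -> U u ->
  (forall x, U x -> induced_metric X x \in unitmx) ->
  \sum_l (partial i (christoffel (induced_metric X) l j k) u
            * induced_metric X u l m
          + christoffel (induced_metric X) l j k u *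
            (lorentz (partial i (partial l X) u) (partial m X u)
             + lorentz (partial l X u) (partial i (partial m X) u))) =
  lorentz (partial i (partial j (partial k X)) u) (partial m X u)
  + lorentz (partial j (partial k X) u) (partial i (partial m X) u).
Proof.
move=> oU sX Uu gU.
have s1 a := smooth_on_derive (delta_mx 0 a) sX.
have s2 a b := smooth_on_derive (delta_mx 0 b) (s1 a).
have dl : is_derive u (delta_mx 0 i)
    (fun x => lorentz (partial j (partial k X) x) (partial m X x))
    (lorentz (partial i (partial j (partial k X)) u) (partial m X u)
     + lorentz (partial j (partial k X) u) (partial i (partial m X) u)).
  apply: is_derive_lorentz; apply: diff_derivable.
    exact: smooth_on_differentiable (s2 _ _) Uu.
  exact: smooth_on_differentiable (s1 _) Uu.
pose F l x := christoffel (induced_metric X) l j k x * induced_metric X x l m.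
have dF l : is_derive u (delta_mx 0 i) (F l)
    (partial i (christoffel (induced_metric X) l j k) u * induced_metric X u l m
     + christoffel (induced_metric X) l j k u *
       (lorentz (partial i (partial l X) u) (partial m X u)
        + lorentz (partial l X u) (partial i (partial m X) u))).
  have dG := derivableP (derivable_christoffel l j k (delta_mx 0 i) oU sX Uu gU).
  apply: is_derive_eq (is_deriveM dG (is_derive_induced_metric i l m sX Uu)) _.
  by rewrite addrC [in RHS]mulrC.
have dS := is_deriveD (dF 0) (dF 1).
rewrite sum_ord2 -(@derive_val _ _ _ _ _ _ _ dS) -(@derive_val _ _ _ _ _ _ _ dl).
apply: (derive_eq_on _ oU Uu) => x Ux.
by have := christoffel_induced_metric j k m oU sX Ux (gU x Ux); rewrite sum_ord2.
Qed.

(** The Gauss equation.  Differentiating [christoffel_induced_metric] expresses the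
derivatives of the Christoffel symbols through third derivatives of X, which
are symmetric and drop out of the curvature; what is left of the second
derivatives of X is their part orthogonal to the surface. *)
Lemma gauss_equation {U X u} i j k m :
  open U -> smooth_on U X -> U u ->
  (forall x, U x -> induced_metric X x \in unitmx) ->
  \sum_l riemann (induced_metric X) l i j k u * induced_metric X u l m =
  lorentz (second_fundamental_form X j k u) (partial i (partial m X) u)
  - lorentz (second_fundamental_form X i k u) (partial j (partial m X) u).
Proof.
move=> oU sX Uu gU.
have sk := smooth_on_derive (delta_mx 0 k) sX.
have Dij := partial_christoffel_metric i j k m oU sX Uu gU.
have Dji := partial_christoffel_metric j i k m oU sX Uu gU.
rewrite (partialC j i oU sk Uu) in Dji.
have C a b := christoffel_induced_metric a b m oU sX Uu (gU u Uu).
rewrite /second_fundamental_form /riemann.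
(* Abstract names for the derivatives, as above. *)
pose P a := partial a X u; pose Q a b := partial a (partial b X) u.
pose G l a b := christoffel (induced_metric X) l a b u.
pose dG c l a b := partial c (christoffel (induced_metric X) l a b) u.
pose g := induced_metric X u.
pose T := partial i (partial j (partial k X)) u.
have {}C a b : \sum_l G l a b * g l m = lorentz (Q a b) (P m) := C a b.
have {}Dij : \sum_l (dG i l j k * g l m + G l j k *
    (lorentz (Q i l) (P m) + lorentz (P l) (Q i m))) =
    lorentz T (P m) + lorentz (Q j k) (Q i m) := Dij.
have {}Dji : \sum_l (dG j l i k * g l m + G l i k *
    (lorentz (Q j l) (P m) + lorentz (P l) (Q j m))) =
    lorentz T (P m) + lorentz (Q i k) (Q j m) := Dji.
change (\sum_l (dG i l j k - dG j l i k
    + \sum_p (G l i p * G p j k - G l j p * G p i k)) * g l m =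
  lorentz (Q j k - \sum_l G l j k *: P l) (Q i m) -
  lorentz (Q i k - \sum_l G l i k *: P l) (Q j m)).
clearbody P Q G dG g T.
(* The goal is Dij - Dji plus multiples of C i _ and C j _ by Christoffel
   symbols; substituting C makes the rest linear in Dij and Dji. *)
rewrite !lorentzDl !lorentzNl !lorentz_suml !sum_ord2 !lorentzZl in Dij Dji *.
have := C i 0; have := C i 1; have := C j 0; have := C j 1.
rewrite !sum_ord2 => Cj1 Cj0 Ci1 Ci0.
move: Dij Dji; rewrite -Cj1 -Cj0 -Ci1 -Ci0 => Dij Dji.
lra.
Qed.

End GaussEquation.

(** * Spacelike planes and their null normals *)

Section LightconeFrame.
Context {R : realType}.
Implicit Types (J : 'M[R]_(2, 4)) (x y z : 'rV[R]_4).

Definition spacelike_rows J : Prop :=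
  forall w : 'rV[R]_2, w != 0 -> 0 < lorentz (w *m J) (w *m J).

Definition perp_rows J z : Prop := forall i, lorentz z (row i J) = 0.

Definition gram J : 'M[R]_2 := \matrix_(i, j) lorentz (row i J) (row j J).

Lemma perp_rows_mulmx J z (w : 'rV_2) :
  perp_rows J z -> lorentz z (w *m J) = 0.
Proof.
by move=> pz; rewrite lorentzC lorentz_mulmxl big1// => i _; rewrite lorentzC pz mulr0.
Qed.

Lemma spacelike_rows_free J : spacelike_rows J -> row_free J.
Proof.
move=> sJ; apply: inj_row_free => w wJ; apply/eqP; apply: contraT => /sJ.
by rewrite wJ lorentz0l ltxx.
Qed.

Lemma perp_rows_sub0 J z : spacelike_rows J -> (z <= J)%MS -> perp_rows J z ->
  z = 0.
Proof.
move=> sJ /submxP[w ->] pz; have [->|/sJ] := eqVneq w 0; first by rewrite mul0mx.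
by rewrite perp_rows_mulmx// ltxx.
Qed.

Lemma gramE J (w : 'rV_2) i : (w *m gram J) 0 i = lorentz (w *m J) (row i J).
Proof.
by rewrite mxE lorentz_mulmxl; apply: eq_bigr => j _; rewrite mxE.
Qed.

Lemma gram_unit J : spacelike_rows J -> gram J \in unitmx.
Proof.
move=> sJ; rewrite -row_free_unit; apply: inj_row_free => w wg.
apply/eqP; apply: contraT => /sJ.
by rewrite perp_rows_mulmx ?ltxx// => i; rewrite -gramE wg mxE.
Qed.

(** The map inside [lorentz_perp], named so that it can carry its linearity. *)
Definition pairings J z : 'rV[R]_2 := \row_i lorentz z (row i J).

Fact pairings_linear J : linear (pairings J).
Proof.
by move=> a z t; apply/rowP => i; rewrite !mxE lorentzDl lorentzZl.
Qed.

HB.instance Definition _ J :=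
  GRing.isLinear.Build R 'rV[R]_4 'rV[R]_2 _ (pairings J) (pairings_linear J).

(** The orthogonal projection fixes the tangent vectors: a spacelike plane meets
its orthogonal complement in 0 only. *)
Lemma lorentz_proj_id J m (B : 'M_(m, 4)) : spacelike_rows J ->
  (B <= J)%MS -> B *m lorentz_proj J = B.
Proof.
move=> sJ BJ; apply: proj_mx_id; last by rewrite genmxE.
apply/eqP; rewrite -submx0; apply/rV_subP => z.
rewrite sub_capmx genmxE => /andP[zJ /sub_kermxP].
rewrite (mul_rV_lin1 (pairings J)) => pz; rewrite (perp_rows_sub0 J z sJ zJ) ?sub0mx// => i.
by have /rowP/(_ i) := pz; rewrite !mxE.
Qed.

Section Frame.
Context {J : 'M[R]_(2, 4)} {x y : 'rV[R]_4}.
Context (sJ : spacelike_rows J) (x0 : lorentz x x = 0) (y0 : lorentz y y = 0)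
  (xy : lorentz x y = - 2) (px : perp_rows J x) (py : perp_rows J y).

Lemma lorentz_frame (w : 'rV_2) a b z :
  lorentz (w *m J + a *: x + b *: y) z =
  lorentz (w *m J) z + a * lorentz x z + b * lorentz y z.
Proof. by rewrite !lorentzDl !lorentzZl. Qed.

Lemma lorentz_frame_x (w : 'rV_2) a b :
  lorentz (w *m J + a *: x + b *: y) x = - 2 * b.
Proof.
rewrite lorentz_frame lorentzC perp_rows_mulmx// x0 (lorentzC y) xy; ring.
Qed.

Lemma lorentz_frame_y (w : 'rV_2) a b :
  lorentz (w *m J + a *: x + b *: y) y = - 2 * a.
Proof.
rewrite lorentz_frame lorentzC perp_rows_mulmx// y0 xy; ring.
Qed.

(** The tangent plane and the two null normals span the whole space: they are
independent, by pairing with the normals and then by positivity on the plane. *)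
Lemma lightcone_frame z : exists (w : 'rV[R]_2) (a b : R),
  z = w *m J + a *: x + b *: y.
Proof.
pose A : 'M_4 := col_mx J (col_mx x y).
have AE (v : 'rV_4) : exists w a b,
    v = row_mx w (row_mx a%:M b%:M) :> 'rV_(2 + (1 + 1)) /\
    v *m A = w *m J + a *: x + b *: y.
  exists (lsubmx (v : 'rV_(2 + 2))),
    (lsubmx (rsubmx (v : 'rV_(2 + (1 + 1)))) 0 0),
    (rsubmx (rsubmx (v : 'rV_(2 + (1 + 1)))) 0 0).
  have vE : v = row_mx (lsubmx (v : 'rV_(2 + 2))) (row_mx
    (lsubmx (rsubmx (v : 'rV_(2 + (1 + 1)))) 0 0)%:M
    (rsubmx (rsubmx (v : 'rV_(2 + (1 + 1)))) 0 0)%:M) :> 'rV_(2 + (1 + 1)).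
    by rewrite -!mx11_scalar !hsubmxK.
  split=> //; have -> : v *m A = (v : 'rV_(2 + (1 + 1))) *m (A : 'M_(2 + (1 + 1), 4)).
    by [].
  by rewrite {1}vE /A mul_row_col (@mul_row_col _ 1 1 1) !mul_scalar_mx addrA.
have fA : row_free A.
  apply: inj_row_free => v; have [w [a [b [-> ->]]]] := AE v => vA.
  have := lorentz_frame_x w a b; have := lorentz_frame_y w a b.
  rewrite vA !lorentz0l => a0 b0.
  have {}a0 : a = 0 by lra.
  have {}b0 : b = 0 by lra.
  move: vA; rewrite a0 b0 !scale0r !addr0 => /eqP.
  rewrite mulmx_free_eq0 ?spacelike_rows_free// => /eqP ->.
  by rewrite !raddf0 !row_mx0.
have /submxP[v ->] : (z <= A)%MS.
  by rewrite submx_full// row_full_unit -row_free_unit.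
by have [w [a [b [_ ->]]]] := AE v; exists w, a, b.
Qed.

(** The coefficients of a vector on x and y are read off from its products with
y and x, so a vector orthogonal to both is tangent. *)
Lemma tangentP z : lorentz z x = 0 -> lorentz z y = 0 -> (z <= J)%MS.
Proof.
have [w [a [b ->]]] := lightcone_frame z.
rewrite lorentz_frame_x lorentz_frame_y => b0 a0.
have {}a0 : a = 0 by lra.
have {}b0 : b = 0 by lra.
by rewrite a0 b0 !scale0r !addr0 submxMl.
Qed.

(** A normal vector only sees the components of t on the two null normals, which
are given by the products of t with them. *)
Lemma lorentz_normal z t : perp_rows J z ->
  lorentz z t =
  - 2^-1 * (lorentz z x * lorentz t y + lorentz z y * lorentz t x).
Proof.
move=> pz; have [w [a [b ->]]] := lightcone_frame t.
rewrite lorentz_frame_x lorentz_frame_y lorentzC lorentz_frame.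
rewrite lorentzC perp_rows_mulmx// (lorentzC x) (lorentzC y); lra.
Qed.

End Frame.
End LightconeFrame.

(** * A surface in the lightcone and its dual *)

Section DualPair.
Context {R : realType} {U : set 'rV[R]_2} {X Xl : 'rV[R]_2 -> 'rV[R]_4}.
Context (openU : open U) (surfX : spacelike_surface U X)
  (dualX : Delta4_dual U X Xl).

Let smoothX : smooth_on U X.
Proof. by case: surfX => -[]. Qed.

Lemma row_jacobian {m} {f : 'rV[R]_2 -> 'rV[R]_m} {u} i : differentiable f u ->
  row i ('J f u) = partial i f u.
Proof. by move=> df; rewrite rowE -deriveEjacobian. Qed.

Lemma surface_differentiable {u} : U u -> differentiable X u.
Proof. exact: smooth_on_differentiable smoothX. Qed.

Let pair_differentiable {u} : U u -> differentiable (fun v => (X v, Xl v)) u.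
Proof.
move=> Uu; case: dualX => -[sL _ _ _] _ _.
exact: smooth_on_differentiable sL Uu.
Qed.

Lemma dual_differentiable {u} : U u -> differentiable Xl u.
Proof.
move=> Uu; apply: (@differentiable_comp _ _ _ _ (fun v => (X v, Xl v)) snd).
  exact: pair_differentiable.
by apply: linear_differentiable => x; exact: cvg_snd.
Qed.

Lemma lightcone_values {u} : U u ->
  [/\ lightlike (X u), lorentz (Xl u) (Xl u) = 0 & lorentz (X u) (Xl u) = - 2].
Proof. by move=> Uu; case: dualX => _ /(_ u Uu)[/= ? [_ ?] ?] _. Qed.

Lemma tangent_perp_dual u i : U u -> lorentz (partial i X u) (Xl u) = 0.
Proof.
move=> Uu; case: dualX => _ _ /(_ u (delta_mx 0 i) Uu).
rewrite /theta41 /= diff_pair/=; last 2 first.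
- exact: surface_differentiable.
- exact: dual_differentiable.
by rewrite -deriveE//; exact: surface_differentiable.
Qed.

(** The contact condition makes X_i orthogonal to the dual; the other relations
of orthogonality come from products that are constant on U. *)
Lemma derive_lorentz_cst (f g : 'rV[R]_2 -> 'rV[R]_4) (c : R) i {u} : U u ->
  differentiable f u -> differentiable g u ->
  (forall x, U x -> lorentz (f x) (g x) = c) ->
  lorentz (partial i f u) (g u) + lorentz (f u) (partial i g u) = 0.
Proof.
move=> Uu /(@diff_derivable _ _ _ _ _ (delta_mx 0 i)) df.
move=> /(@diff_derivable _ _ _ _ _ (delta_mx 0 i)) dg fg.
have [_ <-] := is_derive_lorentz _ _ _ _ df dg.
by rewrite (derive_eq_on _ openU Uu (g := cst c)) ?derive_cst.
Qed.

Lemma tangent_perp_surface u i : U u -> lorentz (partial i X u) (X u) = 0.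
Proof.
move=> Uu; have := derive_lorentz_cst X X 0 i Uu (surface_differentiable Uu) (surface_differentiable Uu).
rewrite (lorentzC (X u)) => /(_ _)/eqP.
rewrite -mulr2n mulrn_eq0/= => H; apply/eqP/H => x Ux.
by have [[]] := lightcone_values Ux.
Qed.

Lemma dual_perp_dual u i : U u -> lorentz (partial i Xl u) (Xl u) = 0.
Proof.
move=> Uu; have := derive_lorentz_cst Xl Xl 0 i Uu (dual_differentiable Uu) (dual_differentiable Uu).
rewrite (lorentzC (Xl u)) => /(_ _)/eqP.
rewrite -mulr2n mulrn_eq0/= => H; apply/eqP/H => x Ux.
by have [] := lightcone_values Ux.
Qed.

Lemma dual_perp_surface u i : U u -> lorentz (partial i Xl u) (X u) = 0.
Proof.
move=> Uu.
have := derive_lorentz_cst X Xl (- 2) i Uu (surface_differentiable Uu) (dual_differentiable Uu).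
rewrite tangent_perp_dual// add0r lorentzC; apply => x Ux.
by have [] := lightcone_values Ux.
Qed.

Lemma jacobian_spacelike {u} : U u -> spacelike_rows ('J X u).
Proof.
move=> Uu w w0; case: surfX => -[_ _ injX _] _ /(_ u w Uu).
rewrite mul_rV_lin1 => sp.
have [] // := sp _; apply: contraNneq w0 => dw.
by apply/eqP/(injX u Uu); rewrite dw raddf0.
Qed.

Lemma jacobian_perp_surface {u} : U u -> perp_rows ('J X u) (X u).
Proof.
move=> Uu i; rewrite row_jacobian; last exact: surface_differentiable.
by rewrite lorentzC tangent_perp_surface.
Qed.

Lemma jacobian_perp_dual {u} : U u -> perp_rows ('J X u) (Xl u).
Proof.
move=> Uu i; rewrite row_jacobian; last exact: surface_differentiable.
by rewrite lorentzC tangent_perp_dual.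
Qed.

(** Why the lightcone shape operator is an endomorphism of the tangent plane with
no projection involved. *)
Lemma dual_jacobian_tangent {u} : U u -> ('J Xl u <= 'J X u)%MS.
Proof.
move=> Uu; have [[_ x0] y0 xy] := lightcone_values Uu.
apply/row_subP => i; rewrite row_jacobian; last exact: dual_differentiable.
apply: (tangentP (jacobian_spacelike Uu) x0 y0 xy (jacobian_perp_surface Uu)
  (jacobian_perp_dual Uu)).
- exact: dual_perp_surface.
- exact: dual_perp_dual.
Qed.

Lemma lightcone_shape_operatorP {u} : U u ->
  lightcone_shape_operator X Xl u *m 'J X u = - 'J Xl u.
Proof.
by move=> Uu; rewrite mulmxKpV// eqmx_opp dual_jacobian_tangent.
Qed.

Lemma tangent_endo_mxK {u} (s : 'M_2) : U u ->
  tangent_endo_mx X u (s *m 'J X u) = s.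
Proof.
move=> Uu; rewrite /tangent_endo_mx mulmxKp// spacelike_rows_free//.
exact: jacobian_spacelike.
Qed.

(** Since both X and its dual have tangent differentials, taking shape operators
is linear in a normal field with constant coefficients on X and its dual, and
the field X itself has shape operator - 1. *)
Lemma shape_operator_normal_comb {u} c d : U u ->
  shape_operator X (fun v => c *: X v + d *: Xl v) u =
  d *: lightcone_shape_operator X Xl u - c%:M.
Proof.
move=> Uu; have dX := surface_differentiable Uu; have dXl := dual_differentiable Uu.
have nE : 'J (fun v => c *: X v + d *: Xl v) u = c *: 'J X u + d *: 'J Xl u.
  have rowD A B i : row i (c *: A + d *: B) = c *: row i A + d *: row i B :> 'rV[R]_4.
    by apply/rowP => k; rewrite !mxE.
  have dcomb : differentiable (fun v => c *: X v + d *: Xl v) u.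
    by apply: differentiableD; apply: differentiableZ.
  apply/row_matrixP => i.
  transitivity (c *: partial i X u + d *: partial i Xl u); last first.
    by rewrite rowD; congr (_ *: _ + _ *: _); apply/esym/row_jacobian.
  apply: etrans (row_jacobian i dcomb) _.
  have dXi := diff_derivable (v := delta_mx 0 i) dX.
  have dXli := diff_derivable (v := delta_mx 0 i) dXl.
  have dcX := @derivableZ _ _ _ _ c _ _ dXi.
  have ddXl := @derivableZ _ _ _ _ d _ _ dXli.
  apply: etrans (deriveD dcX ddXl) _.
  by congr (_ + _); apply: deriveZ.
rewrite /shape_operator.
have -> : 'J (fun v => c *: X v + d *: Xl v) u =
    - ((d *: lightcone_shape_operator X Xl u - c%:M) *m 'J X u).
  rewrite mulmxBl -scalemxAl (lightcone_shape_operatorP Uu) mul_scalar_mx nE.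
  by rewrite scalerN opprB opprK.
rewrite lorentz_proj_id; first by rewrite opprK tangent_endo_mxK.
- exact: jacobian_spacelike.
- by rewrite eqmx_opp submxMl.
Qed.

Lemma shape_operator_nT {u} : U u ->
  shape_operator X (nT X Xl) u =
  2^-1 *: lightcone_shape_operator X Xl u - 2^-1%:M.
Proof.
move=> Uu; rewrite -(shape_operator_normal_comb _ _ Uu).
by congr (shape_operator X _ u); apply/funext => v; rewrite -scalerDr.
Qed.

Lemma shape_operator_nS {u} : U u ->
  shape_operator X (nS X Xl) u =
  - 2^-1 *: lightcone_shape_operator X Xl u - 2^-1%:M.
Proof.
move=> Uu; rewrite -(shape_operator_normal_comb _ _ Uu).
by congr (shape_operator X _ u); apply/funext => v; rewrite scaleNr -scalerBr.
Qed.

Lemma mean_curvature_vectorE {u} : U u ->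
  mean_curvature_vector X Xl u =
  - 2^-1 *: X u + (2^-1 * lightcone_mean_curvature X Xl u) *: Xl u.
Proof.
move=> Uu; rewrite /mean_curvature_vector shape_operator_nT// shape_operator_nS//.
rewrite !linearB /= !linearZ /= !mxtrace_scalar /lightcone_mean_curvature.
move: (\tr _) => T; rewrite /nT /nS.
by apply/rowP => k; rewrite !mxE; field.
Qed.

Lemma gaussian_curvature_vectorE {u} : U u ->
  gaussian_curvature_vector X Xl u =
  (4^-1 * (\det (lightcone_shape_operator X Xl u) + 1)) *: X u
  - (2^-1 * lightcone_mean_curvature X Xl u) *: Xl u.
Proof.
move=> Uu; rewrite /gaussian_curvature_vector shape_operator_nT// shape_operator_nS//.
rewrite /lightcone_mean_curvature; move: (lightcone_shape_operator _ _ _) => s.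
rewrite !det_mx22 /mxtrace sum_ord2 /nT /nS.
by apply/rowP => k; rewrite !mxE /= ?mulr0n ?mulr1n; field.
Qed.

Lemma gram_jacobian {u} : U u -> gram ('J X u) = induced_metric X u.
Proof.
move=> Uu; apply/matrixP => i j; rewrite [LHS]mxE [RHS]mxE !row_jacobian//; exact: surface_differentiable.
Qed.

Lemma induced_metric_unit {u} : U u -> induced_metric X u \in unitmx.
Proof.
by move=> Uu; rewrite -gram_jacobian// gram_unit//; exact: jacobian_spacelike.
Qed.

(** The derivative of the orthogonality of X_j and X. *)
Lemma second_derivative_surface {u} i j : U u ->
  lorentz (partial i (partial j X) u) (X u) = - induced_metric X u i j.
Proof.
move=> Uu; rewrite mxE.
have dXj := smooth_on_differentiable (smooth_on_derive (delta_mx 0 j) smoothX) Uu.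
have := derive_lorentz_cst (partial j X) X 0 i Uu dXj (surface_differentiable Uu).
move=> /(_ (fun x => tangent_perp_surface x j)) /eqP.
by rewrite addr_eq0 => /eqP E; exact (etrans E (congr1 -%R (lorentzC _ _))).
Qed.

(** The derivative of the orthogonality of X_j and the dual, whose derivatives are
given by the lightcone shape operator. *)
Lemma second_derivative_dual {u} i j : U u ->
  lorentz (partial i (partial j X) u) (Xl u) =
  (lightcone_shape_operator X Xl u *m induced_metric X u) i j.
Proof.
move=> Uu.
have -> : (lightcone_shape_operator X Xl u *m induced_metric X u) i j =
    - lorentz (partial j X u) (partial i Xl u).
  rewrite -(gram_jacobian Uu).
  transitivity ((row i (lightcone_shape_operator X Xl u) *m gram ('J X u)) 0 j).
    by rewrite -row_mul [RHS]mxE.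
  rewrite gramE -row_mul (lightcone_shape_operatorP Uu).
  have -> : row i (- 'J Xl u) = - partial i Xl u.
    by rewrite -(row_jacobian i (dual_differentiable Uu)); apply/rowP => k; rewrite !mxE.
  by rewrite (row_jacobian j (surface_differentiable Uu)) lorentzNl lorentzC.
have dXj := smooth_on_differentiable (smooth_on_derive (delta_mx 0 j) smoothX) Uu.
have := derive_lorentz_cst (partial j X) Xl 0 i Uu dXj (dual_differentiable Uu).
move=> /(_ (fun x => tangent_perp_dual x j)) /eqP.
by rewrite addr_eq0 => /eqP.
Qed.

Lemma second_fundamental_form_perp {u} j k : U u ->
  perp_rows ('J X u) (second_fundamental_form X j k u).
Proof.
move=> Uu m; rewrite (row_jacobian m (surface_differentiable Uu)) /second_fundamental_form.
rewrite lorentzDl lorentzNl lorentz_suml.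
rewrite -(christoffel_induced_metric j k m openU smoothX Uu (induced_metric_unit Uu)).
apply/eqP; rewrite subr_eq0; apply/eqP/eq_bigr => l _.
by rewrite lorentzZl; congr (_ * _); rewrite mxE.
Qed.

Lemma second_fundamental_form_surface {u} j k : U u ->
  lorentz (second_fundamental_form X j k u) (X u) = - induced_metric X u j k.
Proof.
move=> Uu; rewrite /second_fundamental_form lorentzDl lorentzNl lorentz_suml.
rewrite (second_derivative_surface _ _ Uu) big1 ?subr0// => l _.
by rewrite lorentzZl tangent_perp_surface ?mulr0.
Qed.

Lemma second_fundamental_form_dual {u} j k : U u ->
  lorentz (second_fundamental_form X j k u) (Xl u) =
  (lightcone_shape_operator X Xl u *m induced_metric X u) j k.
Proof.
move=> Uu; rewrite /second_fundamental_form lorentzDl lorentzNl lorentz_suml.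
rewrite (second_derivative_dual _ _ Uu) big1 ?subr0// => l _.
by rewrite lorentzZl tangent_perp_dual ?mulr0.
Qed.

(** In the Gauss equation, the products of normal parts are mixed terms in the
metric g and in s g, whose alternating sum is the trace of s times det g. *)
Lemma intrinsic_gauss_curvatureE {u} : U u ->
  intrinsic_gauss_curvature X u = lightcone_mean_curvature X Xl u.
Proof.
move=> Uu; rewrite /intrinsic_gauss_curvature /sectional_curvature.
rewrite (gauss_equation 0 1 1 0 openU smoothX Uu (@induced_metric_unit)).
have [[_ x0] y0 xy] := lightcone_values Uu.
(* As above, the derivatives get abstract names. *)
pose Q a b := partial a (partial b X) u.
pose B a b := second_fundamental_form X a b u.
pose h a b := (lightcone_shape_operator X Xl u *m induced_metric X u) a b.
have BQ j k a b : lorentz (B j k) (Q a b) =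
    2^-1 * (induced_metric X u j k * h a b + h j k * induced_metric X u a b).
  have -> := lorentz_normal (jacobian_spacelike Uu) x0 y0 xy
    (jacobian_perp_surface Uu) (jacobian_perp_dual Uu) (B j k) (Q a b)
    (second_fundamental_form_perp j k Uu).
  rewrite (second_fundamental_form_surface j k Uu : lorentz (B j k) _ = _).
  rewrite (second_fundamental_form_dual j k Uu : lorentz (B j k) _ = _).
  rewrite (second_derivative_surface a b Uu : lorentz (Q a b) _ = _).
  rewrite (second_derivative_dual a b Uu : lorentz (Q a b) _ = _) -/(h a b) -/(h j k).
  by move: (h a b) (h j k) => p q; field.
change ((lorentz (B 1 1) (Q 0 0) - lorentz (B 0 1) (Q 1 0))
  / (induced_metric X u 0 0 * induced_metric X u 1 1 - induced_metric X u 0 1 ^+ 2)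
  = lightcone_mean_curvature X Xl u).
clearbody B Q; rewrite (BQ 1 1 0 0) (BQ 0 1 1 0) /h {BQ B Q h}.
have gU := induced_metric_unit Uu; have g10 := induced_metricC X u 1 0.
rewrite /lightcone_mean_curvature /mxtrace sum_ord2.
move: (induced_metric X u) (lightcone_shape_operator X Xl u) gU g10 => g s.
rewrite unitmxE unitfE det_mx22 => g0 g10; rewrite g10 -expr2 in g0.
apply: (canLR (mulfK g0)); rewrite !mxE !sum_ord2 g10.
by field.
Qed.

Lemma isotropic_comb {u} a b : U u -> a != 0 ->
  isotropic (a *: X u + b *: Xl u) <-> b = 0.
Proof.
move=> Uu a0; have [[X0 xx] yy xy] := lightcone_values Uu.
have E : lorentz (a *: X u + b *: Xl u) (a *: X u + b *: Xl u) = - 4 * (a * b).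
  rewrite !(lorentzDl, lorentzDr, lorentzZl, lorentzZr) (lorentzC (Xl u)) xx yy xy.
  by ring.
split=> [iso|b0].
- have : a * b = 0.
    have : - 4 * (a * b) = 0 by rewrite -E; case: iso => [->|[_ ->]//]; exact: lorentz0l.
    by lra.
  by move=> /eqP; rewrite mulf_eq0 (negbTE a0) => /eqP.
- right; split; last by rewrite E b0 mulr0 mulr0.
  by rewrite b0 scale0r addr0 scaler_eq0 negb_or a0.
Qed.

Lemma parallel_comb {u} a b : U u ->
  (a *: X u + b *: Xl u = 0 \/ parallel (a *: X u + b *: Xl u) (X u)) <-> b = 0.
Proof.
move=> Uu; have [[X0 xx] yy xy] := lightcone_values Uu.
have E : lorentz (a *: X u + b *: Xl u) (X u) = - 2 * b.
  by rewrite lorentzDl !lorentzZl (lorentzC (Xl u)) xx xy; ring.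
split=> [par|->].
- suff : - 2 * b = 0 by lra.
  by rewrite -E; case: par => [->|[c _ ->]]; rewrite ?lorentz0l// lorentzZl xx mulr0.
- rewrite scale0r addr0; have [->|a0] := eqVneq a 0; first by left; rewrite scale0r.
  by right; exists a.
Qed.

Lemma half_eq0 (h : R) : 2^-1 * h = 0 <-> h = 0.
Proof. by split=> h0; lra. Qed.

Lemma mean_curvature_vector_isotropic u : U u ->
  isotropic (mean_curvature_vector X Xl u) <-> lightcone_mean_curvature X Xl u = 0.
Proof.
move=> Uu; rewrite (mean_curvature_vectorE Uu) isotropic_comb ?half_eq0//.
by rewrite oppr_eq0 invr_eq0 pnatr_eq0.
Qed.

Lemma mean_curvature_vector_parallel u : U u ->
  (mean_curvature_vector X Xl u = 0 \/ parallel (mean_curvature_vector X Xl u) (X u))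
  <-> lightcone_mean_curvature X Xl u = 0.
Proof.
by move=> Uu; rewrite (mean_curvature_vectorE Uu) parallel_comb// half_eq0.
Qed.

Lemma gaussian_curvature_vector_parallel u : U u ->
  (gaussian_curvature_vector X Xl u = 0 \/
   parallel (gaussian_curvature_vector X Xl u) (X u))
  <-> lightcone_mean_curvature X Xl u = 0.
Proof.
move=> Uu; rewrite (gaussian_curvature_vectorE Uu) -scaleNr parallel_comb//.
by split=> h0; lra.
Qed.

End DualPair.

Theorem theorem7p3 (R : realType) (U : set 'rV[R]_2)
    (X Xl : 'rV[R]_2 -> 'rV[R]_4) (openU : open U)
    (surfX : spacelike_surface U X) (dualX : Delta4_dual U X Xl) :
  [<-> marginally_trapped U X Xl;
       forall u, U u -> lightcone_mean_curvature X Xl u = 0;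
       forall u, U u -> mean_curvature_vector X Xl u = 0 \/
                        parallel (mean_curvature_vector X Xl u) (X u);
       forall u, U u -> intrinsic_gauss_curvature X u = 0;
       forall u, U u -> gaussian_curvature_vector X Xl u = 0 \/
                        parallel (gaussian_curvature_vector X Xl u) (X u)].
Proof.
have meanI := mean_curvature_vector_isotropic openU surfX dualX.
have meanP := mean_curvature_vector_parallel openU surfX dualX.
have gaussP := gaussian_curvature_vector_parallel openU surfX dualX.
have KI := intrinsic_gauss_curvatureE openU surfX dualX.
tfae=> E u Uu.
- by apply/meanI => //; exact: E.
- by apply/meanP => //; exact: E.
- by rewrite KI//; apply/meanP => //; exact: E.
- by apply/gaussP => //; rewrite -KI//; exact: E.
- by apply/meanI => //; apply/gaussP => //; exact: E.
Qed.
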